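(* Let $n,k$ be integers with $n\ge k+1$, let $N=\{1,\dots,n\}$, and let $R\subseteq N$ with $|R|=r>1$. (1) If $k\le2$, then $R$ is a successful coalition. (2) If $k\ge3$, then $R$ is not a successful coalition.
   Context: Each $i\in N$ chooses a set $S_i\subseteq N$ with $|S_i|=k$ and $i\notin S_i$. Given such choices $S_1,\dots,S_n$, an admissible partition is a partition of $N$ into pairwise disjoint parts such that for every part $N_i$ and every $j\in N_i$ we have $S_j\cap N_i\ne\emptyset$. A set $R\subseteq N$ is a successful coalition if there are choices of sets $S_i$ for $i\in R$ (with $|S_i|=k$, $i\notin S_i$) such that for any choices of sets $S_j$ ($|S_j|=k$, $j\notin S_j$) for all $j\in N\setminus R$, and for any admissible partition of $N$ with respect to $S_1,\dots,S_n$, all elements of $R$ lie in the same part. *)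

(* Defs.v *)
From mathcomp Require Import all_boot.

Set Implicit Arguments.
Unset Strict Implicit.
Unset Printing Implicit Defensive.

(* The set N = {1, ..., n} is represented by the ordinals 'I_n = {0, ..., n-1}. *)

(* Only the values of S on A are constrained: S stands for a family of
   choices indexed by A. *)
Definition valid_choices (n k : nat) (A : {set 'I_n})
    (S : 'I_n -> {set 'I_n}) : Prop :=
  forall i : 'I_n, i \in A -> #|S i| = k /\ i \notin S i.

Definition admissible_partition (n : nat) (S : 'I_n -> {set 'I_n})
    (P : {set {set 'I_n}}) : Prop :=
  partition P [set: 'I_n] /\
  forall B : {set 'I_n}, B \in P ->
    forall j : 'I_n, j \in B -> S j :&: B != set0.

Definition combine_choices (n : nat) (R : {set 'I_n})
    (S T : 'I_n -> {set 'I_n}) (i : 'I_n) : {set 'I_n} :=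
  if i \in R then S i else T i.

Definition successful_coalition (n k : nat) (R : {set 'I_n}) : Prop :=
  exists S : 'I_n -> {set 'I_n},
    valid_choices k R S /\
    forall T : 'I_n -> {set 'I_n}, valid_choices k (~: R) T ->
    forall P : {set {set 'I_n}},
      admissible_partition (combine_choices R S T) P ->
      exists B : {set 'I_n}, B \in P /\ R \subset B.

(* Main.v *)
(** View the choices as a digraph with an arc from [i] to every element of
    [S i]; call a vertex set sink-free when each of its vertices has an
    out-neighbour in it.  An admissible partition is one into sink-free parts.

    For [k <= 2] the coalition picks two members [a], [b] and, if [k = 2], a
    third vertex [c]; [a] chooses [b, c], [b] chooses [a, c], the others choose
    [a, b].  Whichever of [b], [c] lies with [a], the part also contains [b].

    For [k >= 3] it suffices to find two disjoint sink-free sets, since these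
    extend to a bipartition of all vertices.  If [#|R| < k], the outsiders
    choose supersets of [R], and two members of [R] form 2-cycles with two
    distinct outsiders.  If [k <= #|R|], the outsiders choose subsets of [R], so
    that every sink-free set meets [R], and one needs Thomassen's theorem that
    out-degree 3 forces two disjoint cycles.  In a minimal counterexample there
    are no 2-cycles, and for each arc [u -> v] the vertices [u], [v] have a common
    in-neighbour, as otherwise [u] could be contracted into [v].  Thus every
    in-neighbourhood has in-degree at least one in itself, hence at least three
    elements, hence (counting arcs) exactly three, and is a directed triangle.
    Removing the triangle [N^-(v)] must leave a sink [u], whose out-neighbourhood
    is then this triangle, and [N^-(u)] is a second triangle disjoint from it. *)

Require Import Defs.
From mathcomp Require Import all_boot.

Set Implicit Arguments.
Unset Strict Implicit.
Unset Printing Implicit Defensive.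

Lemma subset_of_card (T : finType) (A B : {set T}) k :
  A \subset B -> #|A| <= k <= #|B| ->
  exists C : {set T}, [/\ A \subset C, C \subset B & #|C| = k].
Proof.
move=> sAB; elim: k => [|k IHk] /andP[leAk lekB].
  by exists A; split=> //; apply/eqP; rewrite -leqn0.
move: leAk; rewrite leq_eqVlt => /predU1P[eAk|leAk]; first by exists A.
have [|C [sAC sCB cC]] := IHk; first by rewrite -ltnS leAk ltnW.
have /properP[_ [x xB xC]]: C \proper B by rewrite properEcard sCB cC.
exists (x |: C); split; last by rewrite cardsU1 xC cC.
  exact: subset_trans sAC (subsetU1 _ _).
by rewrite subUset sub1set xB.
Qed.

(** * Sink-free sets in finite digraphs *)

Definition sink_free (T : finType) (f : T -> {set T}) (A : {set T}) : bool :=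
  [forall x in A, f x :&: A != set0].

Definition has_disjoint_sink_free (T : finType) (f : T -> {set T})
    (V : {set T}) : Prop :=
  exists A B : {set T},
    [/\ A \subset V /\ B \subset V, [disjoint A & B],
        A != set0 /\ B != set0, sink_free f A & sink_free f B].

Section SinkFree.

Variables (T : finType).
Implicit Types (f g : T -> {set T}) (A B V : {set T}).

Lemma sink_freeP f A :
  reflect (forall x, x \in A -> exists2 y, y \in f x & y \in A)
          (sink_free f A).
Proof.
apply: (iffP forall_inP) => [sfA x /sfA/set0Pn[y] | sfA x /sfA[y fxy Ay]].
  by rewrite inE => /andP[]; exists y.
by apply/set0Pn; exists y; rewrite inE fxy.
Qed.

Lemma sub_sink_free f g A :
  (forall x, f x \subset g x) -> sink_free f A -> sink_free g A.
Proof.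
move=> sfg /sink_freeP sfA; apply/sink_freeP=> x /sfA[y fxy Ay].
by exists y => //; apply: subsetP (sfg x) _ fxy.
Qed.

(** Take [C] maximal among the sink-free sets that contain [B] and avoid [A]. A vertex outside [C]
    and [A] with all its out-neighbours in [C] could be added to [C], so the complement is sink-free
    too. *)
Lemma sink_free_bipartition f A B :
  (forall x, f x != set0) -> [disjoint A & B] ->
  sink_free f A -> sink_free f B ->
  exists C, [/\ A \subset ~: C, B \subset C, sink_free f C & sink_free f (~: C)].
Proof.
move=> f0 dAB /sink_freeP sfA sfB.
pose ok C := sink_free f C && (A \subset ~: C).
have okB : ok B by rewrite /ok sfB -disjoints_subset.
have [C /maxsetP[/andP[sfC sAC] maxC] sBC] := maxset_exists okB.
exists C; split=> //; apply/sink_freeP=> x; rewrite inE => xC.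
have [fxC|/subsetPn[y fxy yC]] := boolP (f x \subset C); last first.
  by exists y; rewrite ?inE.
have [xA|xA] := boolP (x \in A).
  by have [y fxy yA] := sfA x xA; exists y => //; apply: subsetP sAC _ yA.
suff okxC : ok (x |: C).
  by move: xC; rewrite -(maxC _ okxC (subsetU1 _ _)) setU11.
apply/andP; split; last first.
  apply/subsetP=> y yA; rewrite !inE negb_or.
  have := subsetP sAC y yA; rewrite inE => ->; rewrite andbT.
  by apply: contraNneq xA => <-.
apply/sink_freeP=> y /setU1P[->|/(sink_freeP _ _ sfC)[z fyz zC]]; last first.
  by exists z; rewrite ?inE ?zC ?orbT.
have /set0Pn[z fxz] := f0 x.
by exists z; rewrite // !inE (subsetP fxC _ fxz) orbT.
Qed.

(** Contraction of the arc from [u] to [v]: arcs into [u] are redirected to [v]; [u] itself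
    disappears only when the vertex set is restricted to [V :\ u]. *)
Definition contract u v f x : {set T} :=
  if u \in f x then v |: f x :\ u else f x.

(** A redirected arc into [v] is replaced by the path through [u], so [u] joins [A] when [v] is in
    it. *)
Lemma sink_free_contract u v f A :
  v \in f u -> sink_free (contract u v f) A ->
  sink_free f (if v \in A then u |: A else A).
Proof.
move=> fuv /sink_freeP sfA; case: ifPn => vA; apply/sink_freeP=> x.
  case/setU1P=> [->|xA]; first by exists v => //; rewrite !inE vA orbT.
  have [y] := sfA x xA; rewrite /contract; case: ifP => [fxu _ _|_ fxy yA].
    by exists u; rewrite ?setU11.
  by exists y; rewrite // !inE yA orbT.
move=> xA; have [y] := sfA x xA; rewrite /contract; case: ifP => [fxu|_].
  rewrite !inE => /predU1P[->|/andP[_ fxy] yA]; first by rewrite (negPf vA).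
  by exists y.
by exists y.
Qed.

(** At most one of the two disjoint sets contains [v], so at most one receives [u]. *)
Lemma has_disjoint_sink_free_contract u v f V :
  u \in V -> v \in f u ->
  has_disjoint_sink_free (contract u v f) (V :\ u) ->
  has_disjoint_sink_free f V.
Proof.
move=> uV fuv [A [B [[sAV sBV] dAB [A0 B0] sfA sfB]]].
have uA : u \notin A by apply/negP=> /(subsetP sAV); rewrite !inE eqxx.
have uB : u \notin B by apply/negP=> /(subsetP sBV); rewrite !inE eqxx.
exists (if v \in A then u |: A else A), (if v \in B then u |: B else B).
have sub (C : {set T}) :
    C \subset V :\ u -> (if v \in C then u |: C else C) \subset V.
  move=> /subset_trans/(_ (subD1set _ _)) sCV.
  by case: ifP; rewrite ?subUset ?sub1set ?uV.
have neq0 (C : {set T}) : C != set0 -> (if v \in C then u |: C else C) != set0.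
  by case: ifP => // _ _; apply/set0Pn; exists u; rewrite setU11.
split; [by rewrite !sub | | by rewrite !neq0 | |];
  try exact: sink_free_contract.
have [vA|vA] := ifPn; have [vB|vB] := ifPn => //.
- by have:= disjointFr dAB vA; rewrite vB.
- by rewrite -setI_eq0 setIUl setU_eq0 !setI_eq0 disjoints1 uB.
- by rewrite -setI_eq0 setIUr setU_eq0 setIC !setI_eq0 disjoints1 uA.
Qed.

(** Induction on [#|V|], by deletion or contraction of a vertex of [V]. Out-degree exactly 3 makes
    the average in-degree 3. *)
Lemma has_disjoint_sink_free_outdegree3 f V :
  V != set0 ->
  (forall x, x \in V -> [/\ f x \subset V, x \notin f x & #|f x| = 3]) ->
  has_disjoint_sink_free f V.
Proof.
have [m] := ubnP #|V|; elim: m V f => // m IHm V f.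
rewrite ltnS => leVm /set0Pn[x0 x0V] fV.
have fsub x y : x \in V -> y \in f x -> y \in V.
  by move=> /fV[/subsetP sfV _ _] /sfV.
have loopless x y : x \in V -> y \in f x -> y != x.
  by case/fV=> _ xfx _ fxy; apply: contraNneq xfx => {1}<-.
have V1 v : V :\ v != set0.
  have [/subset_leq_card sfV _ c3] := fV x0 x0V.
  move: sfV; rewrite c3 (cardsD1 v V) -card_gt0.
  by case: #|_| => //; case: (v \in V).
have ltV1 v : v \in V -> #|V :\ v| < m.
  by move=> vV; apply: leq_trans leVm; rewrite [X in _ < X](cardsD1 v) vV.
have complement A : A \subset V -> A != set0 -> sink_free f A ->
    {in V :\: A, forall x, ~~ (f x \subset A)} -> V :\: A != set0 ->
    has_disjoint_sink_free f V.
  move=> sAV A0 sfA fxA VA0; exists A, (V :\: A); split=> //.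
  - by rewrite sAV subsetDl.
  - by rewrite -setI_eq0 setIDA setIC -setIDA setDv setI0.
  apply/sink_freeP=> x xVA; have /subsetPn[y fxy yA] := fxA x xVA.
  by exists y; rewrite // inE yA; case/setDP: xVA => xV _; apply: fsub fxy.
have [/exists_inP[x xV /exists_inP[y fxy fyx]]|no2] :=
    boolP [exists x in V, exists y in f x, x \in f y].
  (* The two vertices of a 2-cycle cannot contain three out-neighbours, so the rest of [V] is
     sink-free. *)
  have yV := fsub x y xV fxy.
  have le2 : #|[set x; y]| <= 2 by rewrite cards2; case: eqP.
  have no_sub z : z \in V -> ~~ (f z \subset [set x; y]).
    move=> /fV[_ _ c3]; apply: contraTN le2 => /subset_leq_card.
    by rewrite c3 -ltnNge.
  apply: (complement [set x; y]).
  - by rewrite subUset !sub1set xV.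
  - by apply/set0Pn; exists x; rewrite set21.
  - apply/sink_freeP=> z /set2P[]->; first by exists y; rewrite ?set22.
    by exists x; rewrite ?set21.
  - by move=> z /setDP[zV _]; apply: no_sub.
  rewrite setD_eq0; apply: contra (no_sub x xV); apply: subset_trans.
  by case: (fV x xV).
have asym x y : x \in V -> y \in f x -> x \notin f y.
  move=> xV fxy; apply: contraNN no2 => fyx.
  by apply/exists_inP; exists x => //; apply/exists_inP; exists y.
have [/forall_inP cin|/forall_inPn[u uV /forall_inPn[v fuv nocin]]] := boolP
    [forall u in V, forall v in f u,
       [exists w in V, (u \in f w) && (v \in f w)]]; last first.
  (* Without a common in-neighbour of [u] and [v], redirecting never merges two arcs, so out-degrees
     stay 3; the absence of 2-cycles prevents a loop at [v]. *)
  have vV := fsub u v uV fuv; have vu := loopless u v uV fuv.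
  apply: (has_disjoint_sink_free_contract uV fuv).
  apply: IHm (V1 u) _ => [|x]; first exact: ltV1.
  case/setD1P=> xu xV; have [sfV xfx c3] := fV x xV; rewrite /contract.
  case: ifP => fxu; last by rewrite subsetD1 sfV fxu.
  have nfxv : v \notin f x.
    apply: contra nocin => fxv; apply/exists_inP; exists x => //; exact/andP.
  split.
  - by rewrite subUset sub1set !inE vu vV setSD.
  - rewrite !inE xu (negPf xfx) orbF.
    by apply: contraTneq fxu => ->; apply: asym.
  - by rewrite cardsU1 !inE vu (negPf nfxv) -c3 (cardsD1 u (f x)) fxu.
pose inn v := [set x in V | v \in f x].
have innP v u : u \in inn v -> exists2 w, w \in inn v & u \in f w.
  rewrite inE => /andP[uV fuv]; have /forall_inP/(_ v fuv) := cin u uV.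
  by case/exists_inP=> w wV /andP[fwu fwv]; exists w; rewrite // inE wV.
have [/forall_inP inn0|/forall_inPn[v vV]] :=
    boolP [forall v in V, inn v != set0]; last first.
  (* A vertex without in-neighbours can be deleted without changing the other out-degrees. *)
  rewrite negbK => /eqP inn0.
  have [||x /setD1P[xv xV]|A [B [[sAV sBV] dAB n0 sfA sfB]]] :=
      IHm (V :\ v) f.
  - exact: ltV1.
  - exact: V1.
  - have [sfV xfx c3] := fV x xV; split=> //.
    rewrite subsetD1 sfV; apply/negP=> fxv.
    by have := in_set0 x; rewrite -inn0 inE xV fxv.
  by exists A, B; split; rewrite // !(subset_trans _ (subD1set V v)).
have inn_sub v : inn v \subset V by apply/subsetP=> x /setIdP[].
(* Two backward steps inside [inn v]; [q] differs from [u] because there are no 2-cycles. *)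
have path3 v u : u \in inn v -> exists p q,
    [/\ p \in inn v, q \in inn v, u \in f p, p \in f q & uniq [:: u; p; q]].
  move=> uv; have [p pv fpu] := innP v u uv; have [q qv fqp] := innP v p pv.
  have [pV qV] : p \in V /\ q \in V by case/setIdP: pv; case/setIdP: qv.
  exists p, q; split=> //=; rewrite !inE negb_or.
  rewrite (loopless p u) // (loopless q p) // !andbT.
  by apply: contraTneq fqp => <-; apply: asym.
have path3_sub v u p q : p \in inn v -> q \in inn v -> u \in inn v ->
    [set:: [:: u; p; q]] \subset inn v.
  move=> pv qv uv; apply/subsetP=> z; rewrite in_set !in_cons in_nil orbF.
  by move=> /or3P[] /eqP->.
have card_inn_ge v : v \in V -> 3 <= #|inn v|.
  move=> vV; have /set0Pn[u uv] := inn0 v vV.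
  have [p [q [pv qv _ _ Upq]]] := path3 v u uv.
  have := subset_leq_card (path3_sub v u p q pv qv uv).
  by rewrite cardsE (card_uniqP Upq).
have card_inn v : v \in V -> #|inn v| = 3.
  have arcs : \sum_(v in V) #|inn v| = \sum_(v in V) 3.
    transitivity (\sum_(v in V) \sum_(x in V | v \in f x) 1).
      by apply: eq_bigr => w _; rewrite sum1dep_card.
    rewrite (exchange_big_dep (mem V)) /= => [|w x _ /andP[] //].
    apply: eq_bigr => x xV.
    have [sfV _ <-] := fV x xV; rewrite sum1dep_card; apply: eq_card => y.
    by rewrite inE xV /=; apply: andb_idl => /(subsetP sfV).
  move=> vV; apply/eqP; rewrite eqn_leq card_inn_ge // andbT leqNgt.
  apply/negP=> gt3; have := ltnn (\sum_(v in V) 3); rewrite -{2}arcs.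
  rewrite (bigD1 v) //= [X in _ < X](bigD1 v) //= -addSn leq_add //.
  by apply: leq_sum => w /andP[wV _]; apply: card_inn_ge.
have sf_inn v : v \in V -> sink_free f (inn v).
  move=> vV; apply/sink_freeP=> u uv.
  have [p [q [pv qv fpu fqp Upq]]] := path3 v u uv.
  have innE : [set:: [:: u; p; q]] = inn v.
    apply/eqP; rewrite eqEcard path3_sub // card_inn //.
    by rewrite cardsE (card_uniqP Upq).
  have [w wv fwq] := innP v q qv; have qV : q \in V by case/setIdP: qv.
  have wV : w \in V by case/setIdP: wv.
  (* Among [u], [p], [q], only [w = u] avoids loops and 2-cycles, which closes the triangle. *)
  move: wv fwq (loopless w q wV); rewrite -innE !inE => /or3P[] /eqP->.
  - by move=> fuq _; exists q; rewrite // innE.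
  - by move=> fpq; have := asym q p qV fqp; rewrite fpq.
  - by move=> fqq /(_ fqq); rewrite eqxx.
have [/existsP[u /andP[uV /eqP fu]]|noin] :=
    boolP [exists u, (u \in V) && (f u == inn x0)].
  (* Without 2-cycles no out-neighbour of [u] is an in-neighbour, so the two triangles are
     disjoint. *)
  exists (f u), (inn u); rewrite {3 4}fu; split.
  - by have [-> _ _] := fV u uV; rewrite inn_sub.
  - rewrite disjoint_subset; apply/subsetP=> x fux.
    by rewrite !inE (negPf (asym u x uV fux)) andbF.
  - by rewrite !inn0.
  - exact: sf_inn.
  - exact: sf_inn.
apply: (complement (inn x0)).
- exact: inn_sub.
- exact: inn0.
- exact: sf_inn.
- move=> x /setDP[xV _]; apply: contra noin => sfx; apply/existsP; exists x.
  by have [_ _ c3] := fV x xV; rewrite xV eqEcard sfx card_inn ?c3.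
apply/set0Pn; exists x0; rewrite !inE x0V andbT.
by have [_ /negPf->] := fV x0 x0V.
Qed.

(** Every out-neighbourhood shrinks to three vertices; a sink-free set stays so when arcs are put
    back. *)
Lemma has_disjoint_sink_free_outdegree_ge3 f :
  [set: T] != set0 -> (forall x, x \notin f x) -> (forall x, 3 <= #|f x|) ->
  has_disjoint_sink_free f [set: T].
Proof.
move=> T0 xf f3.
have /fin_all_exists[g gP] x : exists C : {set T}, C \subset f x /\ #|C| = 3.
  have [|C [_ sCf c3]] := @subset_of_card T set0 (f x) 3 (sub0set _).
    by rewrite cards0 f3.
  by exists C.
have [|A [B [sAB dAB n0 sfA sfB]]] :=
    has_disjoint_sink_free_outdegree3 T0 (f := g).
  move=> x _; have [sgf g3] := gP x; split; rewrite ?subsetT //.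
  exact: contra (subsetP sgf x) (xf x).
have sgf x : g x \subset f x by have [] := gP x.
by exists A, B; split=> //; apply: (sub_sink_free sgf).
Qed.

End SinkFree.

(** * Coalitions and admissible partitions *)

Section Coalition.

Variables (n k : nat).
Implicit Types (R : {set 'I_n}) (S T : 'I_n -> {set 'I_n}).

Lemma admissible_partition_pblock S (P : {set {set 'I_n}}) i :
  admissible_partition S P -> exists2 y, y \in S i & pblock P y = pblock P i.
Proof.
case=> /and3P[/eqP covP tiP _] adm.
have iP : i \in cover P by rewrite covP inE.
have ii : i \in pblock P i by rewrite mem_pblock.
have /set0Pn[y] := adm _ (pblock_mem iP) i ii.
by case/setIP=> Siy yi; exists y => //; apply: same_pblock.
Qed.

Lemma successful_coalition_le2 R :
  k < n -> 1 < #|R| -> k <= 2 -> successful_coalition k R.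
Proof.
move=> ltkn /card_gt1P[a [b [aR bR ab]]] le2k.
have [k0|k_gt0] := posnP k.
  (* For [k = 0] the member [a] has no out-neighbour, so no admissible partition exists. *)
  exists (fun _ => set0); split=> [i _|T _ P admP].
    by rewrite cards0 k0 inE.
  have [y] := admissible_partition_pblock a admP.
  by rewrite /combine_choices aR inE.
have cab : #|[set a; b]| = 2 by rewrite cards2 ab.
(* [D] is empty for [k = 1] and the singleton of [c] for [k = 2]; [E] below is the singleton of [a],
   respectively the pair of [a] and [b]. *)
have [|D [_ sDab cD]] :=
    @subset_of_card _ set0 (~: [set a; b]) k.-1 (sub0set _).
  rewrite cards0 /= -(leq_add2l #|[set a; b]|) cardsC card_ord cab.
  by rewrite addSn add1n prednK.
have [|E [aE sEab cE]] := @subset_of_card _ [set a] [set a; b] k (subsetUl _ _).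
  by rewrite cards1 cab k_gt0.
have notD x : x \in [set a; b] -> x \notin D.
  by move=> xab; apply/negP=> /(subsetP sDab); rewrite inE xab.
have [aD bD] := (notD a (set21 a b), notD b (set22 a b)).
pose S i := if i == a then b |: D else if i == b then a |: D else E.
exists S; split=> [i iR|T _ P admP].
  rewrite /S; have [->|ia] := eqVneq i a.
    by rewrite cardsU1 bD cD add1n prednK // !inE (negPf ab).
  have [->|ib] := eqVneq i b.
    by rewrite cardsU1 aD cD add1n prednK // !inE eq_sym (negPf ab).
  split=> //; apply/negP=> /(subsetP sEab).
  by rewrite !inE (negPf ia) (negPf ib).
have [/and3P[/eqP covP tiP _] _] := admP.
have same i : i \in R -> exists2 y, y \in S i & pblock P y = pblock P i.
  move=> iR; have := admissible_partition_pblock i admP.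
  by rewrite /combine_choices iR.
have ab_same : pblock P b = pblock P a.
  have [y] := same a aR; rewrite /S eqxx => /setU1P[->//|yD yaP].
  have [z] := same b bR; rewrite /S eq_sym (negPf ab) eqxx.
  case/setU1P=> [->//|zD <-].
  (* The out-neighbours [y] of [a] and [z] of [b] both lie in [D], which has at most one element, so
     they coincide. *)
  have /card_le1_eqP D1 : #|D| <= 1 by rewrite cD -ltnS prednK.
  by rewrite (D1 y z).
have aP : a \in cover P by rewrite covP inE.
exists (pblock P a); split; first exact: pblock_mem.
apply/subsetP=> i iR.
suff <- : pblock P i = pblock P a by rewrite mem_pblock covP inE.
have [->//|ia] := eqVneq i a; have [->//|ib] := eqVneq i b.
have [y] := same i iR; rewrite /S (negPf ia) (negPf ib).
by move=> /(subsetP sEab)/set2P[]-> <-.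
Qed.

Lemma admissible_bipartition S (C : {set 'I_n}) :
  C != set0 -> ~: C != set0 -> sink_free S C -> sink_free S (~: C) ->
  admissible_partition S [set C; ~: C].
Proof.
move=> C0 C'0 /forall_inP sfC /forall_inP sfC'; split; last first.
  by move=> B /set2P[]-> j; [apply: sfC | apply: sfC'].
have CC' : C != ~: C.
  by apply: contraNneq C0 => eC; rewrite -(setIid C) {2}eC setICr.
apply/and3P; split.
- by rewrite /cover bigcup_setU !big_set1 setUCr.
- apply/trivIsetP=> A B /set2P[]-> /set2P[]->; rewrite ?eqxx // => _.
    by rewrite disjoints_subset setCK.
  by rewrite disjoints_subset.
- by rewrite !inE !(eq_sym set0) negb_or C0.
Qed.

Lemma not_successful_coalition_ge3 R :
  k < n -> 1 < #|R| -> 3 <= k -> ~ successful_coalition k R.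
Proof.
move=> ltkn R1 k3 [S [validS succS]].
have k_gt0 : 0 < k by apply: leq_trans k3.
have cardC1 j : #|~: [set j] : {set 'I_n}| = n.-1.
  by rewrite cardsC1 card_ord.
have /fin_all_exists[T TP] j : exists C : {set 'I_n}, j \notin R ->
    [/\ #|C| = k, j \notin C & if k <= #|R| then C \subset R else R \subset C].
  have [jR|jR] := boolP (j \in R); first by exists set0.
  have [lekR|ltRk] := leqP k #|R|.
    have [|C [_ sCR cC]] := @subset_of_card _ set0 R k (sub0set _).
      by rewrite cards0.
    by exists C; split=> //; apply: contra (subsetP sCR j) jR.
  have [||C [sRC sCj cC]] := @subset_of_card _ R (~: [set j]) k.
  - by rewrite subsetC sub1set inE.
  - by rewrite cardC1 (ltnW ltRk) -ltnS (ltn_predK ltkn).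
  by exists C; split=> //; apply/negP=> /(subsetP sCj); rewrite !inE eqxx.
pose g := combine_choices R S T.
have gP i : #|g i| = k /\ i \notin g i.
  rewrite /g /combine_choices; case: ifPn => [/validS//|/TP[]//].
suff [C [sfC sfC' RC RC']] : exists C : {set 'I_n},
    [/\ sink_free g C, sink_free g (~: C), ~~ (R \subset C)
      & ~~ (R \subset ~: C)].
  have validT : valid_choices k (~: R) T.
    by move=> i; rewrite inE => /TP[].
  have [|B []] := succS T validT [set C; ~: C].
    apply: admissible_bipartition => //.
      by apply: contraNneq RC' => ->; rewrite setC0 subsetT.
    by apply: contraNneq RC => C'0; rewrite -(setCK C) C'0 setC0 subsetT.
  by case/set2P=> ->; apply/negP.
have g0 i : g i != set0 by rewrite -card_gt0 (gP i).1.
have [lekR|ltRk] := leqP k #|R|.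
  have [||i|A [B [_ dAB [A0 B0] sfA sfB]]] :=
      @has_disjoint_sink_free_outdegree_ge3 _ g.
  - by rewrite -card_gt0 cardsT card_ord (leq_ltn_trans _ ltkn).
  - by move=> i; have [] := gP i.
  - by rewrite (gP i).1.
  have [C [sAC sBC sfC sfC']] := sink_free_bipartition g0 dAB sfA sfB.
  (* An outsider in [D] has all its out-neighbours in [R], and one of them lies in [D]. *)
  have meetR D : D != set0 -> sink_free g D -> ~~ (R \subset ~: D).
    move=> /set0Pn[x xD] /sink_freeP/(_ x xD)[y].
    rewrite /g /combine_choices; case: ifPn => [xR _ _|xR].
      by apply/subsetPn; exists x; rewrite // inE negbK.
    have [_ _] := TP x xR; rewrite lekR => /subsetP sTR /sTR yR yD.
    by apply/subsetPn; exists y; rewrite // inE negbK.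
  exists C; split=> //; last first.
    by apply: meetR => //; apply: contraNneq B0 => C0; rewrite -subset0 -C0.
  have := meetR (~: C); rewrite setCK; apply=> //.
  by apply: contraNneq A0 => C0; rewrite -subset0 -C0.
have /card_gt1P[a [b [aR bR ab]]] := R1.
have gR i : i \in R -> g i = S i by rewrite /g /combine_choices => ->.
have gNR i : i \notin R -> R \subset g i.
  move=> iR; have [_ _] := TP i iR; rewrite leqNgt ltRk.
  by rewrite /g /combine_choices (negPf iR).
(* [#|g i :&: R| <= #|R| - 1] because [i] is not in [g i] *)
have out i : i \in R -> 1 < #|g i :\: R|.
  move=> iR; have [ci ii] := gP i.
  have: #|g i :&: R| < #|R|.
    apply: proper_card; apply/properP; split; first exact: subsetIr.
    by exists i; rewrite // inE (negPf ii).
  move: ci; rewrite -(cardsID R) => ci ltR.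
  rewrite -(ltn_add2l #|g i :&: R|) ci addn1.
  exact: leq_ltn_trans ltR ltRk.
have /card_gt0P[c /setDP[gac cR]] : 0 < #|g a :\: R| by apply: ltnW (out a aR).
(* Two candidates for [b], since one of them may be [c]. *)
have /card_gt1P[d1 [d2 [/setDP[gbd1 d1R] /setDP[gbd2 d2R] d12]]] := out b bR.
have [d gbd [dR dc]] : exists2 d, d \in g b & d \notin R /\ d != c.
  have [d1c|] := eqVneq d1 c; last by exists d1.
  by exists d2; rewrite // -d1c eq_sym.
have sf2 x y : x \in R -> y \notin R -> y \in g x -> sink_free g [set x; y].
  move=> xR yR gxy; apply/sink_freeP=> z /set2P[]->.
    by exists y; rewrite ?set22.
  by exists x; rewrite ?set21 // (subsetP (gNR y yR)).
have dis : [disjoint [set a; c] & [set b; d]].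
  rewrite disjoints_subset subUset !sub1set !inE !negb_or ab (eq_sym c d) dc.
  rewrite andbT; apply/andP; split; first by apply: contraNneq dR => <-.
  by apply: contraNneq cR => ->.
have [C [sAC sBC sfC sfC']] :=
  sink_free_bipartition g0 dis (sf2 a c aR cR gac) (sf2 b d bR dR gbd).
exists C; split=> //; apply/subsetPn.
  by exists a => //; have := subsetP sAC a (set21 a c); rewrite inE.
by exists b; rewrite // inE negbK (subsetP sBC) ?set21.
Qed.

End Coalition.

Theorem theorem5p1 (n k : nat) (hnk : k + 1 <= n)
    (R : {set 'I_n}) (r : nat) (hR : #|R| = r) (hr : 1 < r) :
  (k <= 2 -> successful_coalition k R) /\
  (3 <= k -> ~ successful_coalition k R).
Proof.
have ltkn : k < n by rewrite -addn1.
have R1 : 1 < #|R| by rewrite hR.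
split; [exact: successful_coalition_le2 | exact: not_successful_coalition_ge3].
Qed.
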